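(* Let $N,K,d$ be integers with $1\le K\le N$ and $0\le d<N$. In the Best-1 case of the Sliding-Window Secretary Problem with $N$ applicants, window size $K$ and threshold $d$, for every integer $a$ with $d<a\le N$, setting $q=\left\lceil\frac{a-d}{K}\right\rceil>0$, $$\sigma_q(a)=\sigma_{q-1}(d+(q-1)K)+\frac1N\sum_{j=d+(q-1)K+1}^{a}\left(1-\sum_{r=-1}^{q-2}f_r(d+rK)-f_{q-1}(j-K)\right).$$
   Context: Setting (Best-1 case). There are $N$ applicants with indices $1,\dots,N$. $R$ is a uniformly random permutation of $\{1,\dots,N\}$; $R(m)$ is the rank of the applicant at index $m$, with $1$ the best rank. When the window starts at index $i$ it consists of applicants $i,\dots,\min(i+K-1,N)$, and exactly the applicants $1,\dots,\min(i+K-1,N)$ have been seen. Under the sliding rule, applicant $i$ is a candidate iff $R(i)=\min\{R(1),\dots,R(\min(i+K-1,N))\}$. The strategy with threshold $d$ rejects the first $d$ applicants, and then stops at (chooses) the first index $i>d$ such that applicant $i$ is a candidate. It wins iff the chosen applicant has rank $1$. For an integer $a$ with $q=\lceil (a-d)/K\rceil\ge 1$: $f_q(a)$ denotes the probability that this strategy stops at an index in $[d+(q-1)K+1,\,a]$, and $\sigma_q(a)$ denotes the probability that the strategy wins with a candidate whose index is in $[1,a]$. By convention $f_q(a)=0$ and $\sigma_q(a)=0$ for $q<1$, $a\le d$. *)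

(* Defs.v *)
From HB Require Import structures.
From mathcomp Require Import all_boot all_order all_algebra all_fingroup.

Set Implicit Arguments.
Unset Strict Implicit.
Unset Printing Implicit Defensive.

Import Order.TTheory GRing.Theory Num.Theory.
Local Open Scope ring_scope.

(* The integers m, m + 1, ..., n; empty when n < m. *)
Definition zrange (m n : int) : seq int :=
  if m <= n then [seq m + k%:Z | k <- iota 0 `|n - m|%N.+1] else [::].

(* Uniform probability on the permutations of 'I_N. *)
Definition Pr (N : nat) (E : {set 'S_N}) : rat := #|E|%:R / #|{: 'S_N}|%:R.

(* Ordinals are 0-based whereas indices and ranks are 1-based: i : 'I_N stands
   for the applicant with index i + 1, and its rank under R is R i + 1. *)
Definition idx (N : nat) (i : 'I_N) : nat := i.+1.
Definition rk (N : nat) (R : 'S_N) (i : 'I_N) : nat := (R i).+1.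

(* The applicants seen when the window of size K starts at applicant i. *)
Definition seen (N K : nat) (i : 'I_N) : {set 'I_N} :=
  [set m : 'I_N | (idx m <= minn (idx i + K - 1) N)%N].

(* All ranks are at most N, so N is neutral for their minimum. *)
Definition candidate (N K : nat) (R : 'S_N) (i : 'I_N) : bool :=
  rk R i == \big[minn/N]_(m in seen K i) rk R m.

Definition stops_at (N K d : nat) (R : 'S_N) (i : 'I_N) : bool :=
  [&& (d < idx i)%N, candidate K R i &
      [forall j : 'I_N, (d < idx j < idx i)%N ==> ~~ candidate K R j]].

Definition wins_at (N K d : nat) (R : 'S_N) (i : 'I_N) : bool :=
  stops_at K d R i && (rk R i == 1%N).

(* In f and sigma the intended arguments satisfy q = ceil ((a - d) / K); the
   value 0 for q < 1 or a <= d is the convention. *)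
Definition f (N K d : nat) (q a : int) : rat :=
  if (1 <= q) && (d%:Z < a) then
    Pr [set R : 'S_N | [exists i : 'I_N, stops_at K d R i &&
          (d%:Z + (q - 1) * K%:Z + 1 <= (idx i)%:Z <= a)]]
  else 0.

Definition sigma (N K d : nat) (q a : int) : rat :=
  if (1 <= q) && (d%:Z < a) then
    Pr [set R : 'S_N | [exists i : 'I_N, wins_at K d R i &&
          (1 <= (idx i)%:Z <= a)]]
  else 0.

(* Main.v *)
(* The strategy wins at index j iff R(j) = 1 and no index in (d, j - K] is a
   candidate. Candidates up to j - K are determined by the relative order of the
   first j - 1 applicants, which is independent of the event R(j) = 1, so the win
   at j has probability 1/N times that of not having stopped by j - K. The latter
   is a distribution function, which the sum of the f_r telescopes to. *)
Require Import Defs.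
From HB Require Import structures.
From mathcomp Require Import all_boot all_order all_algebra all_fingroup.
From mathcomp Require Import zify ring.

Set Implicit Arguments.
Unset Strict Implicit.
Unset Printing Implicit Defensive.

Import Order.TTheory GRing.Theory Num.Theory.
Local Open Scope ring_scope.

Lemma leq_bigmin (I : finType) (P : pred I) (F : I -> nat) (x m : nat) :
  (m <= \big[minn/x]_(i | P i) F i)%N = (m <= x)%N && [forall (i | P i), (m <= F i)%N].
Proof.
rewrite -big_andE; elim/big_rec2: _ => [|i b y _ IH]; first by rewrite andbT.
by rewrite leq_min IH andbCA.
Qed.

Lemma candidateE (N K : nat) (R : 'S_N) (i : 'I_N) : (0 < K)%N ->
  candidate K R i = [forall (m | m \in seen K i), (R i <= R m)%N].
Proof.
move=> K_gt0; rewrite /candidate eqn_leq leq_bigmin ltn_ord /=.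
set b := [forall (m | _), _]; suff -> : (\big[minn/N]_(m in seen K i) rk R m <= rk R i)%N.
  by rewrite andbT.
(* As [0 < K], applicant [i] lies in its own window, so the minimum is at most its rank. *)
have iS : i \in seen K i by rewrite inE leq_min ltn_ord andbT /idx; lia.
by have := leqnn (\big[minn/N]_(m in seen K i) rk R m);
  rewrite [in X in X -> _]leq_bigmin => /andP[_ /forall_inP/(_ i iS)].
Qed.

Lemma candidate_order (N K : nat) (R S : 'S_N) (i : 'I_N) : (0 < K)%N ->
    {in seen K i, forall m, (R i <= R m)%N = (S i <= S m)%N} ->
  candidate K R i = candidate K S i.
Proof.
move=> K_gt0 RS; rewrite !candidateE //.
by apply: eq_forallb => m; apply/implyb_id2l => /RS ->.
Qed.

Lemma stops_at_inj (N K d : nat) (R : 'S_N) (i j : 'I_N) :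
  stops_at K d R i -> stops_at K d R j -> i = j.
Proof.
move=> /and3P[di ci /forallP hi] /and3P[dj cj /forallP hj].
have := hi j; have := hj i; rewrite ci cj di dj /= !implybF -!leqNgt /idx => ij ji.
by apply: ord_inj; lia.
Qed.

(** The least candidate index beyond [d] is where the strategy stops. Having stopped by [b] thus
    depends only on which indices up to [b] are candidates. *)
Lemma stops_at_exists (N K d : nat) (R : 'S_N) (b : int) :
  [exists i, stops_at K d R i && ((idx i)%:Z <= b)] =
  [exists i, [&& (d < idx i)%N, candidate K R i & (idx i)%:Z <= b]].
Proof.
apply/existsP/existsP => [[i /andP[/and3P[di ci _] ib]]|[i0 i0P]].
  by exists i; apply/and3P.
pose P i := [&& (d < idx i)%N, candidate K R i & (idx i)%:Z <= b].
have [i /and3P[di ci ib] imin] := arg_minnP (fun i : 'I_N => idx i) (i0P : P i0).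
exists i; rewrite /stops_at di ci ib !andbT /=.
apply/forallP => j; apply/implyP => /andP[dj ji]; apply/negP => cj.
have /imin : P j by rewrite /P dj cj /=; lia.
by rewrite leqNgt ji.
Qed.

(** For fixed [R] at most one [i] satisfies [E R i], so counting the pairs [(R, i)] in either order
    gives additivity. *)
Lemma Pr_exists (N : nat) (E : 'S_N -> pred 'I_N) (P : pred 'I_N) :
    (forall R i j, E R i -> E R j -> i = j) ->
  Pr [set R : 'S_N | [exists i, E R i && P i]] =
  \sum_(i | P i) Pr [set R : 'S_N | E R i].
Proof.
move=> Einj; rewrite /Pr -mulr_suml; congr (_ / _).
rewrite -natr_sum -sum1_card; congr (_%:R).
rewrite (eq_bigr (fun i => \sum_(R : 'S_N | E R i) 1)%N); last first.
  by move=> i _; rewrite -sum1_card; apply: eq_bigl => R; rewrite inE.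
rewrite (exchange_big_dep predT) //= big_mkcond /=; apply: eq_bigr => R _.
rewrite inE; case: existsP => [[i /andP[Ei Pi]]|nE].
  rewrite (bigD1 i) ?Pi //= big1 // => j /andP[/andP[_ Ej] /eqP ji].
  by case: ji; apply: Einj Ej Ei.
by rewrite big1 // => i /andP[Pi Ei]; case: nE; exists i; rewrite Ei.
Qed.

Lemma PrC (N : nat) (E : {set 'S_N}) : Pr (~: E) = 1 - Pr E.
Proof.
have nz : #|{: 'S_N}|%:R != 0 :> rat.
  by rewrite pnatr_eq0 -lt0n; apply/card_gt0P; exists 1%g.
by rewrite /Pr cardsCs setCK natrB ?max_card // mulrBl divff.
Qed.

(** Away from [v] the permutation is [lift w] after the inverse of [lift v], and both are
    increasing. *)
Lemma lift_perm_mono (n : nat) (v w : 'I_n.+1) :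
  {in predC1 v &, {mono lift_perm v w 1%g : x y / (x <= y)%N}}.
Proof.
move=> x y; rewrite !inE ![_ == v]eq_sym => /unlift_some[x' -> _] /unlift_some[y' -> _].
by rewrite !lift_perm_lift !perm1 /= /bump; lia.
Qed.

(* Composing with the monotone relabelling of the ranks that sends the rank v
   of j to w exchanges the fibres of R |-> R j without changing E. *)
Lemma Pr_fibre (n : nat) (E : {set 'S_n.+1}) (j w : 'I_n.+1) :
    (forall R S : 'S_n.+1,
      {in predC1 j &, forall x y, (R x <= R y)%N = (S x <= S y)%N} ->
      (R \in E) = (S \in E)) ->
  Pr [set R in E | R j == w] = n.+1%:R^-1 * Pr E.
Proof.
move=> hE.
have fib v : #|[set R in E | R j == v]| = #|[set R in E | R j == w]|.
  pose c : 'S_n.+1 := lift_perm v w 1%g.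
  have cv : c v = w by rewrite lift_perm_id.
  rewrite -(card_preimset [set R in E | R j == w] (@mulIg _ c)).
  congr #|pred_of_set _|; apply/setP => R; rewrite !inE permM -cv (inj_eq perm_inj).
  have [Rj|] := eqVneq (R j) v; rewrite ?andbF ?andbT //.
  apply: hE => x y; rewrite !inE => xj yj; rewrite !permM lift_perm_mono ?inE //.
    by rewrite -Rj (inj_eq perm_inj).
  by rewrite -Rj (inj_eq perm_inj).
rewrite /Pr; have -> : #|E| = (n.+1 * #|[set R in E | R j == w]|)%N.
  rewrite -[LHS]sum1_card (partition_big (fun R : 'S_n.+1 => R j) predT) //=.
  under eq_bigr => v _ do rewrite sum1dep_card fib.
  by rewrite sum_nat_const card_ord.
by rewrite natrM -!mulrA mulKf // pnatr_eq0.
Qed.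

(** The bound is an integer because it is later taken at points such as [idx j - K], which may be
    negative. *)
Definition stop_cdf (N K d : nat) (b : int) : rat :=
  \sum_(i : 'I_N | (idx i)%:Z <= b) Pr [set R | stops_at K d R i].

Definition win_cdf (N K d : nat) (b : int) : rat :=
  \sum_(i : 'I_N | (idx i)%:Z <= b) Pr [set R | wins_at K d R i].

Lemma sum_idx_sub (N : nat) (G : 'I_N -> rat) (a b : int) : a <= b ->
  \sum_(i : 'I_N | (idx i)%:Z <= b) G i - \sum_(i : 'I_N | (idx i)%:Z <= a) G i
  = \sum_(i : 'I_N | a < (idx i)%:Z <= b) G i.
Proof.
move=> ab; rewrite (bigID (fun i => (idx i)%:Z <= a)) /=.
rewrite (eq_bigl (fun i => (idx i)%:Z <= a)) => [|i]; last by lia.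
by rewrite addrC addrK; apply: eq_bigl => i; lia.
Qed.

Lemma stop_cdf0 (N K d : nat) (b : int) : b <= d%:Z -> stop_cdf N K d b = 0.
Proof.
move=> bd; apply: big1 => i ib; rewrite /Pr (_ : [set _ | _] = set0) ?cards0 ?mul0r //.
by apply/setP => R; rewrite !inE /stops_at; lia.
Qed.

Lemma win_cdf0 (N K d : nat) (b : int) : b <= d%:Z -> win_cdf N K d b = 0.
Proof.
move=> bd; apply: big1 => i ib; rewrite /Pr (_ : [set _ | _] = set0) ?cards0 ?mul0r //.
by apply/setP => R; rewrite !inE /wins_at /stops_at; lia.
Qed.

(** The case [n = 0] absorbs the convention: both points are then at most [d], where [stop_cdf]
    vanishes just as [f] does. *)
Lemma f_cdf (N K d : nat) (n : nat) (a : int) : (0 < K)%N ->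
    d%:Z + (n%:Z - 1) * K%:Z < a <= d%:Z + n%:Z * K%:Z ->
  f N K d n%:Z a = stop_cdf N K d a - stop_cdf N K d (d%:Z + (n%:Z - 1) * K%:Z).
Proof.
move=> K_gt0 /andP[na an]; rewrite /f.
case: n => [|n] in na an *; first by rewrite !stop_cdf0 ?subrr //; lia.
have -> /= : (1 <= n.+1%:Z) && (d%:Z < a) by nia.
rewrite sum_idx_sub; last by lia.
rewrite (@Pr_exists _ (fun R => stops_at K d R)
  (fun i => d%:Z + (n.+1%:Z - 1) * K%:Z + 1 <= (idx i)%:Z <= a)); last first.
  by move=> R i j; apply: stops_at_inj.
by apply: eq_bigl => i; lia.
Qed.

(** The bound on [a] matters for [n = 0], where it forces [a <= d] and both sides vanish. *)
Lemma sigma_cdf (N K d : nat) (n : nat) (a : int) :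
    a <= d%:Z + n%:Z * K%:Z ->
  sigma N K d n%:Z a = win_cdf N K d a.
Proof.
move=> an; rewrite /sigma; case: ifPn => [na|na]; last first.
  by rewrite win_cdf0 //; nia.
rewrite (@Pr_exists _ (fun R => wins_at K d R)
  (fun i => 1 <= (idx i)%:Z <= a)); last first.
  by move=> R i j /andP[si _] /andP[sj _]; apply: stops_at_inj si sj.
by apply: eq_bigl => i; rewrite /idx; lia.
Qed.

Lemma zrange_nat (p a : nat) :
  zrange (p%:Z + 1) a%:Z = [seq k%:Z | k <- index_iota p.+1 a.+1].
Proof.
rewrite /zrange /index_iota; case: ifPn => pa; last first.
  by rewrite (_ : a.+1 - p.+1 = 0)%N //; lia.
have -> : `|a%:Z - (p%:Z + 1)%R|%N.+1 = (a.+1 - p.+1)%N by lia.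
rewrite -[p.+1]addn0 iotaDl -map_comp; apply: eq_map => k /=; lia.
Qed.

Lemma sum_zrange (N p a : nat) (G : int -> rat) : (a <= N)%N ->
  \sum_(j <- zrange (p%:Z + 1) a%:Z) G j =
  \sum_(i : 'I_N | p%:Z < (idx i)%:Z <= a%:Z) G (idx i)%:Z.
Proof.
move=> aN; rewrite zrange_nat big_map big_add1 /= (big_nat_widen _ _ N) //.
rewrite (big_nat_widenl _ 0%N) // big_mkord.
by apply: eq_bigl => i; rewrite /idx; lia.
Qed.

(** Each term with [r >= 0] is the increment of [stop_cdf] over a whole block of length [K], so the
    sum telescopes; the term [r = -1] is 0 by convention. *)
Lemma sum_f (N K d n : nat) : (0 < K)%N ->
  \sum_(r <- zrange (-1) (n%:Z - 1)) f N K d r (d%:Z + r * K%:Z) =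
  stop_cdf N K d (d%:Z + (n%:Z - 1) * K%:Z).
Proof.
move=> K_gt0; rewrite /zrange.
have -> : -1 <= n%:Z - 1 by lia.
have -> : `|(n%:Z - 1)%R - (-1)%R|%N = n by lia.
rewrite big_map; elim: n => [|n IH].
  by rewrite /= big_seq1 stop_cdf0 //; lia.
rewrite -[n.+2]addn1 iotaD big_cat /= IH big_seq1 add0n.
have -> : -1 + n.+1%:Z = n%:Z by lia.
have -> : n.+1%:Z - 1 = n%:Z by lia.
by rewrite f_cdf ?subrKC //; nia.
Qed.

(* Applicants in (idx j - K, idx j) see j in their windows, so if j is best they
   are no candidates; the earlier ones are judged without looking at j. *)
Lemma Pr_wins_at (N K d : nat) (j : 'I_N) : (0 < K)%N -> (d < idx j)%N ->
  Pr [set R | wins_at K d R j] =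
  N%:R^-1 * (1 - stop_cdf N K d ((idx j)%:Z - K%:Z)).
Proof.
case: N j => [[]//|n] j K_gt0 dj; set b := (idx j)%:Z - K%:Z.
rewrite /stop_cdf -(@Pr_exists _ (fun R => stops_at K d R)
  (fun i => (idx i)%:Z <= b)); last by move=> R i k; apply: stops_at_inj.
rewrite -PrC -(@Pr_fibre _ _ j ord0); last first.
  move=> R S RS; rewrite !inE !stops_at_exists; congr (~~ _).
  apply: eq_existsb => i; congr (_ && _); apply: andb_id2r => ib.
  (* Since [idx i <= idx j - K], the window of [i] ends at [idx i + K - 1 < idx j], so [j] is not
     among the seen applicants. *)
  apply: candidate_order => // m; rewrite inE => mi; apply: RS; rewrite inE;
    by apply/eqP => jE; subst; move: ib mi; rewrite /b /idx; lia.
congr Pr; apply/setP => R; rewrite !inE /wins_at /rk eqSS.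
have -> : (R j == ord0) = (R j == 0%N :> nat) by [].
have [Rj|] := eqVneq (R j : nat) 0%N; rewrite ?andbF ?andbT //.
rewrite stops_at_exists /stops_at dj /=.
have -> /= : candidate K R j.
  by rewrite candidateE //; apply/forallP => m; rewrite Rj implybT.
rewrite negb_exists; apply/forallP/forallP => h i.
  apply/negP => /and3P[di ci ib]; have := h i; rewrite di ci.
  by rewrite andTb implybF; move: ib; rewrite /b; lia.
apply/implyP => /andP[di ij]; apply/negP => ci.
have := h i; rewrite di ci /= -ltNge => bi.
(* Here [idx j - K < idx i < idx j], so [i] sees [j]; being a candidate it would share the best rank
   with [j]. *)
move: ci; rewrite candidateE // => /forallP/(_ j)/implyP.
rewrite inE leq_min ltn_ord andbT.
have -> : (idx j <= idx i + K - 1)%N by move: bi; rewrite /b; lia.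
rewrite Rj leqn0 => /(_ isT)/eqP Ri.
have /perm_inj ij' : R i = R j by apply/val_inj; rewrite /= Ri Rj.
by rewrite ij' ltnn in ij.
Qed.

Theorem theorem3p6 (N K d : nat) (hK : (1 <= K <= N)%N) (hd : (d < N)%N)
    (a : int) (ha : d%:Z < a <= N%:Z) :
  let q : int := Num.ceil ((a - d%:Z)%:~R / K%:R : rat) in
  0 < q /\
  sigma N K d q a =
    sigma N K d (q - 1) (d%:Z + (q - 1) * K%:Z)
    + 1 / N%:R *
      \sum_(j <- zrange (d%:Z + (q - 1) * K%:Z + 1) a)
        (1 - \sum_(r <- zrange (-1) (q - 2)) f N K d r (d%:Z + r * K%:Z)
           - f N K d (q - 1) (j - K%:Z)).
Proof.
move=> q; have K_gt0 : (0 < K)%N by lia.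
have KR : 0 < K%:R :> rat by rewrite ltr0n.
(* The ceiling enters only through the fact that [a] lies in the block from [d + (q - 1) * K]
   (excluded) to [d + q * K] (included). *)
have q_lb : (q - 1) * K%:Z < a - d%:Z.
  have := ceilB1_lt ((a - d%:Z)%:~R / K%:R : rat).
  by rewrite ltr_pdivlMr // -[K%:R]/(K%:Z%:~R) -intrM ltr_int.
have q_ub : a - d%:Z <= q * K%:Z.
  have := ceil_ge ((a - d%:Z)%:~R / K%:R : rat).
  by rewrite ler_pdivrMr // -[K%:R]/(K%:Z%:~R) -intrM ler_int.
have q_gt0 : 0 < q by nia.
split=> //; clearbody q.
have [n qE] : exists n : nat, q = n.+1%:Z by exists `|q|%N.-1; lia.
have [m aE] : exists m : nat, a = m%:Z by exists `|a|%N; lia.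
subst q a.
have -> : n.+1%:Z - 1 = n%:Z by lia.
have -> : n.+1%:Z - 2 = n%:Z - 1 by lia.
rewrite !sigma_cdf; [|by lia..].
(* The difference of the two [sigma] values is a sum of winning probabilities over the last block,
   compared term by term with the right-hand side. *)
apply/eqP; rewrite addrC -subr_eq; apply/eqP.
have -> : d%:Z + n%:Z * K%:Z = (d + n * K)%N%:Z by lia.
rewrite sum_idx_sub; last by lia.
rewrite (@sum_zrange N); last by lia.
rewrite mulr_sumr; apply: eq_bigr => i /andP[pi im].
rewrite Pr_wins_at ?div1r //; last by lia.
(* Shifting [idx i] back by [K] lands in the preceding block, so [f_cdf] applies, and the value of
   [stop_cdf] at the start of that block cancels. *)
rewrite sum_f // f_cdf //; last by nia.
by congr (_ * _); ring.
Qed.
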